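(* Let $X$ and $Y$ be Banach spaces and $T\in\mathcal{L}(X,Y)$. If $T\in\mathrm{QNA}(X,Y)$, then $T^*\in\mathrm{NA}(Y^*,X^* )$. Moreover, if $T$ quasi attains its norm toward $y_0\in Y$ with $\|y_0\|=\|T\|$, then $T^*$ attains its norm at any $y^*\in S_{Y^*}$ such that $y^*(y_0)=\|y_0\|$.
   Context: Banach spaces are over $\mathbb{K}=\mathbb{R}$ or $\mathbb{C}$; $B_X$ and $S_X$ are the closed unit ball and unit sphere of $X$; $\mathcal{L}(X,Y)$ is the space of bounded linear operators with the operator norm; $T^*\colon Y^*\to X^*$ is the adjoint. $T\in\mathrm{NA}(X,Y)$ if $\|Tx_0\|=\|T\|$ for some $x_0\in B_X$; $T$ attains its norm at $x_0\in S_X$ if $\|Tx_0\|=\|T\|$. $T\in\mathrm{QNA}(X,Y)$ if there is $u\in\overline{T(B_X)}$ (norm closure) with $\|u\|=\|T\|$; in this case $T$ is said to quasi attain its norm toward $u$. *)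

(* Defs.v *)
From HB Require Import structures.
From mathcomp Require Import all_boot all_order all_algebra.
From mathcomp Require Import all_classical all_reals all_analysis.
From mathcomp Require Import complex.

Set Implicit Arguments.
Unset Strict Implicit.
Unset Printing Implicit Defensive.

Import Order.TTheory GRing.Theory Num.Theory.
Import numFieldNormedType.Exports.

Local Open Scope classical_set_scope.
Local Open Scope ring_scope.

Inductive scalar_kind := RealScalars | ComplexScalars.

Definition scalars (R : realType) (k : scalar_kind) : numFieldType :=
  match k with
  | RealScalars => R
  | ComplexScalars => R[i]
  end.

(* The norm of a [normedModType K] takes its values in [K], as nonnegative
   elements.  When [K] is [R[i]], these are the complex numbers [a +i* 0] with
   [0 <= a], and suprema have to be taken in [R]. *)
Definition scalar_of_real (R : realType) (k : scalar_kind) :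
    R -> scalars R k :=
  match k return R -> scalars R k with
  | RealScalars => fun a => a
  | ComplexScalars => fun a => (a%:C)%C
  end.

Definition real_of_scalar (R : realType) (k : scalar_kind) :
    scalars R k -> R :=
  match k return scalars R k -> R with
  | RealScalars => fun z : R => z
  | ComplexScalars => fun z : R[i] => complex.Re z
  end.

Section scalars_theory.
Context {R : realType} {k : scalar_kind}.
Implicit Types (a b : R) (z : scalars R k).

Lemma scalar_of_realK : cancel (@scalar_of_real R k) (@real_of_scalar R k).
Proof. by case: k. Qed.

Lemma ler_scalar_of_real a b :
  (scalar_of_real k a <= scalar_of_real k b) = (a <= b).
Proof. by case: k => //=; rewrite lecR. Qed.

Lemma scalar_of_realD a b :
  scalar_of_real k (a + b) = scalar_of_real k a + scalar_of_real k b.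
Proof. by case: k => //=; rewrite rmorphD. Qed.

Lemma scalar_of_realM a b :
  scalar_of_real k (a * b) = scalar_of_real k a * scalar_of_real k b.
Proof. by case: k => //=; rewrite rmorphM. Qed.

Lemma scalar_of_real0 : @scalar_of_real R k 0 = 0.
Proof. by case: k. Qed.

Lemma scalar_of_real1 : @scalar_of_real R k 1 = 1.
Proof. by case: k. Qed.

Lemma real_of_scalarK z : 0 <= z -> scalar_of_real k (real_of_scalar z) = z.
Proof.
case: k z => //= -[a b]; rewrite lecE /= => /andP[/eqP -> _].
by [].
Qed.

Lemma ler_real_of_scalar z1 z2 : 0 <= z1 -> 0 <= z2 ->
  (real_of_scalar z1 <= real_of_scalar z2) = (z1 <= z2).
Proof. by move=> z10 z20; rewrite -ler_scalar_of_real !real_of_scalarK. Qed.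

End scalars_theory.

Definition unit_ball (K : numFieldType) (X : normedModType K) : set X :=
  [set x | `|x| <= 1].

Definition unit_sphere (K : numFieldType) (X : normedModType K) : set X :=
  [set x | `|x| = 1].

Arguments unit_ball {K} X.
Arguments unit_sphere {K} X.

Definition bounded_linear (K : numFieldType) (X Y : normedModType K) :
    {pred X -> Y} :=
  fun f => `[< linear f /\ exists M : K, forall x, `|f x| <= M * `|x| >].

Record bounded_op (K : numFieldType) (X Y : normedModType K) := BoundedOp {
  bounded_op_fun :> X -> Y;
  bounded_op_prop : bounded_op_fun \in @bounded_linear K X Y }.

Section bounded_op_lmodule.
Context {K : numFieldType} {X Y : normedModType K}.

HB.instance Definition _ := [isSub for @bounded_op_fun K X Y].
HB.instance Definition _ := [Choice of bounded_op X Y by <:].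

Lemma bounded_linear_submod_closed : submod_closed (@bounded_linear K X Y).
Proof.
split=> [|a f g].
  apply/asboolP; split; first by move=> c x y; rewrite /= scaler0 addr0.
  by exists 0 => x; rewrite normr0 mul0r.
move=> /asboolP[lf [M fM]] /asboolP[lg [N gN]]; apply/asboolP; split.
  move=> c x y.
  change (a *: f (c *: x + y) + g (c *: x + y) =
    c *: (a *: f x + g x) + (a *: f y + g y)).
  by rewrite lf lg !scalerDr !scalerA mulrC addrACA.
exists (`|a| * M + N) => x; rewrite mulrDl -mulrA.
change (`|a *: f x + g x| <= `|a| * (M * `|x|) + N * `|x|).
by rewrite (le_trans (ler_normD _ _))// normrZ lerD// ler_wpM2l.
Qed.

HB.instance Definition _ :=
  GRing.isSubmodClosed.Build _ _ (@bounded_linear K X Y)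
    bounded_linear_submod_closed.
HB.instance Definition _ := [SubChoice_isSubLmodule of bounded_op X Y by <:].

Lemma bounded_op_linear (T : bounded_op X Y) : linear T.
Proof. by have /asboolP[] := bounded_op_prop T. Qed.

HB.instance Definition _ (T : bounded_op X Y) :=
  GRing.isLinear.Build K X Y *:%R T (bounded_op_linear T).

Lemma bounded_op_eqP (S T : bounded_op X Y) : (S : X -> Y) =1 T -> S = T.
Proof. by move=> ST; apply/val_inj/funext. Qed.

Lemma bounded_opDE (S T : bounded_op X Y) x : (S + T) x = S x + T x.
Proof. by []. Qed.

Lemma bounded_opZE (c : K) (T : bounded_op X Y) x : (c *: T) x = c *: T x.
Proof. by []. Qed.

Lemma bounded_op0E x : (0 : bounded_op X Y) x = 0.
Proof. by []. Qed.

End bounded_op_lmodule.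

Section operator_norm.
Context {R : realType} {k : scalar_kind}.
Context {X Y : normedModType (scalars R k)}.
Implicit Types (S T : bounded_op X Y) (x : X) (M : scalars R k).

Definition ball_norms T : set R :=
  [set real_of_scalar `|T x| | x in unit_ball X].

Definition opnorm T : scalars R k := scalar_of_real k (sup (ball_norms T)).

Lemma has_sup_ball_norms T : has_sup (ball_norms T).
Proof.
split.
  by exists (real_of_scalar `|T 0|), 0 => //=; rewrite /unit_ball /= normr0.
have /asboolP[_ [M TM]] := bounded_op_prop T.
have MM x : x \in unit_ball X -> `|T x| <= `|M|.
  rewrite inE /unit_ball /= => x1; have [->|x0] := eqVneq x 0.
    by rewrite linear0 normr0.
  have M0 : 0 <= M.
    by move: (le_trans (normr_ge0 (T x)) (TM x)); rewrite pmulr_lge0 ?normr_gt0.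
  by rewrite (le_trans (TM x))// ger0_norm// ler_piMr.
exists (real_of_scalar `|M|) => _ [x x1 <-].
by rewrite ler_real_of_scalar// MM// inE.
Qed.

Lemma opnorm_ge0 T : 0 <= opnorm T.
Proof.
rewrite /opnorm -scalar_of_real0 ler_scalar_of_real.
apply: (ub_le_sup (proj2 (has_sup_ball_norms T))).
exists 0; first by rewrite /unit_ball /= normr0.
by rewrite linear0 normr0 -[in LHS](@scalar_of_real0 R k) scalar_of_realK.
Qed.

Lemma opnorm_ub T x : `|x| <= 1 -> `|T x| <= opnorm T.
Proof.
move=> x1; rewrite -[leLHS]real_of_scalarK// ler_scalar_of_real.
by apply: (ub_le_sup (proj2 (has_sup_ball_norms T))); exists x.
Qed.

Lemma opnorm_least T M :
  0 <= M -> (forall x, `|x| <= 1 -> `|T x| <= M) -> opnorm T <= M.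
Proof.
move=> M0 TM; rewrite -[leRHS]real_of_scalarK// ler_scalar_of_real.
apply: ge_sup; first exact: (proj1 (has_sup_ball_norms T)).
by move=> _ [x x1 <-]; rewrite ler_real_of_scalar// TM.
Qed.

Lemma opnormP T x : `|T x| <= opnorm T * `|x|.
Proof.
have [->|x0] := eqVneq x 0; first by rewrite linear0 !normr0 mulr0.
have nx0 : 0 < `|x| by rewrite normr_gt0.
have : `|T (`|x|^-1 *: x)| <= opnorm T.
  by apply: opnorm_ub; rewrite normrZ normfV normr_id mulVf ?gt_eqF.
by rewrite linearZ /= normrZ normfV normr_id mulrC ler_pdivrMr.
Qed.

Lemma opnormD S T : opnorm (S + T) <= opnorm S + opnorm T.
Proof.
apply: opnorm_least => [|x x1]; first by rewrite addr_ge0// opnorm_ge0.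
by rewrite bounded_opDE (le_trans (ler_normD _ _))// lerD// opnorm_ub.
Qed.

Lemma opnormZ_le (c : scalars R k) T : opnorm (c *: T) <= `|c| * opnorm T.
Proof.
apply: opnorm_least => [|x x1]; first by rewrite mulr_ge0// opnorm_ge0.
by rewrite bounded_opZE normrZ ler_wpM2l// opnorm_ub.
Qed.

Lemma opnormZ (c : scalars R k) T : opnorm (c *: T) = `|c| * opnorm T.
Proof.
have [->|c0] := eqVneq c 0.
  rewrite normr0 mul0r scale0r; apply/eqP; rewrite eq_le opnorm_ge0 andbT.
  by apply: opnorm_least => // x _; rewrite bounded_op0E normr0.
apply/eqP; rewrite eq_le opnormZ_le /= mulrC -ler_pdivlMr ?normr_gt0//.
rewrite mulrC -normfV -[T in leLHS]scale1r -(mulVf c0) -scalerA.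
exact: opnormZ_le.
Qed.

Lemma opnorm0_eq0 T : opnorm T = 0 -> T = 0.
Proof.
move=> T0; apply: bounded_op_eqP => x; apply/eqP.
by rewrite bounded_op0E -normr_le0 (le_trans (opnormP T x))// T0 mul0r.
Qed.

HB.instance Definition _ := Lmodule_isNormed.Build (scalars R k)
  (bounded_op X Y) opnormD opnormZ opnorm0_eq0.

Lemma opnormE T : `|T| = opnorm T.
Proof. by []. Qed.

End operator_norm.

Definition dual (K : numFieldType) (X : normedModType K) := bounded_op X K^o.

HB.instance Definition _ (R : realType) (k : scalar_kind)
  (X : normedModType (scalars R k)) := NormedModule.on (dual X).

Section adjoint.
Context {R : realType} {k : scalar_kind}.
Context {X Y : normedModType (scalars R k)}.
Implicit Types (T : bounded_op X Y).

Lemma adjoint_fun_subproof T (g : dual Y) :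
  (fun x => g (T x) : (scalars R k)^o) \in @bounded_linear _ X (scalars R k)^o.
Proof.
apply/asboolP; split; first by move=> a x y; rewrite !linearP.
exists (opnorm g * opnorm T) => x; rewrite (le_trans (opnormP g _))//.
by rewrite -mulrA ler_wpM2l ?opnorm_ge0// opnormP.
Qed.

Definition adjoint_fun T (g : dual Y) : dual X :=
  BoundedOp (adjoint_fun_subproof T g).

Lemma adjoint_subproof T : adjoint_fun T \in @bounded_linear _ (dual Y) (dual X).
Proof.
apply/asboolP; split.
  by move=> a g h; apply: bounded_op_eqP.
exists (opnorm T) => g; apply: opnorm_least => [|x x1].
  by rewrite mulr_ge0// opnorm_ge0.
rewrite (le_trans (opnormP g _))// mulrC.
by rewrite ler_wpM2r ?opnorm_ge0// opnorm_ub.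
Qed.

Definition adjoint T : bounded_op (dual Y) (dual X) :=
  BoundedOp (adjoint_subproof T).

End adjoint.

Section norm_attainment.
Context {R : realType} {k : scalar_kind}.
Context {X Y : normedModType (scalars R k)}.
Implicit Types (T : bounded_op X Y).

Definition NA T := exists2 x0, unit_ball X x0 & `|T x0| = `|T|.

Definition attains_norm_at T (x0 : X) := unit_sphere X x0 /\ `|T x0| = `|T|.

Definition quasi_attains_norm_toward T (u : Y) :=
  closure (T @` unit_ball X) u /\ `|u| = `|T|.

Definition QNA T := exists u, quasi_attains_norm_toward T u.

End norm_attainment.

(* Main.v *)
From HB Require Import structures.
Require Import Defs.
From mathcomp Require Import all_boot all_order all_algebra.
From mathcomp Require Import all_classical all_reals all_analysis.
From mathcomp Require Import complex ring lra.
Import Order.TTheory GRing.Theory Num.Theory.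
Import numFieldNormedType.Exports.
Local Open Scope ring_scope.

(* If [T x] is close to [y0] for some [x] in the unit ball, then [ystar (T x)] is
   close to [ystar y0 = |y0| = |T|], whence [|T^* ystar| >= |T| >= |T^*|].  The
   first assertion thus reduces to finding a functional norming [y0], that is to
   the Hahn-Banach theorem.  The latter is obtained without extending from
   subspaces: by Zorn's lemma there is a minimal sublinear functional below the
   norm, and minimal sublinear functionals are linear, because the functional
   [x |-> inf_(t >= 0) (q (x + t a) - t q a)] is sublinear and below [q]. *)

(** * Sublinear functionals and the Hahn-Banach theorem *)

Definition sublinear {R : realType} {V : lmodType R} (p : V -> R) : Prop :=
  (forall x y, p (x + y) <= p x + p y) /\
  (forall (c : R) x, 0 <= c -> p (c *: x) = c * p x).

Section sublinear_functionals.
Context {R : realType} {V : lmodType R}.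
Implicit Types (p q : V -> R) (F : set (V -> R)).

Lemma sublinear0 {p} : sublinear p -> p 0 = 0.
Proof. by move=> [_ pZ]; rewrite -[in LHS](scale0r 0) pZ// mul0r. Qed.

Lemma sublinear_ge_opp {p} x : sublinear p -> - p (- x) <= p x.
Proof.
by move=> sp; rewrite -subr_ge0 opprK -(sublinear0 sp) -[in leLHS](subrr x) sp.1.
Qed.

Lemma sublinear_of_le {p} :
  (forall x y, p (x + y) <= p x + p y) ->
  (forall (c : R) x, 0 < c -> p (c *: x) <= c * p x) -> sublinear p.
Proof.
move=> pD pZ; split=> // c x; rewrite le_eqVlt => /predU1P[<-|c0].
  rewrite scale0r mul0r.
  (* The factors [2] and [1/2] give [0 <= p 0] and [p 0 <= 0]. *)
  have := pZ 2 0 ltac:(lra); have := pZ 2^-1 0 ltac:(lra).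
  by rewrite !scaler0; lra.
apply/eqP; rewrite eq_le pZ//= mulrC -ler_pdivlMr// mulrC.
by rewrite -[in leLHS](scalerK (lt0r_neq0 c0) x) pZ// invr_gt0.
Qed.

Definition pointwise_inf F : V -> R := fun x => inf [set q x | q in F].

(** The common lower bound [p] ensures that [inf] is a genuine infimum and not its default value. *)
Lemma pointwise_inf_le {F p} q x :
  (forall q y, F q -> p y <= q y) -> F q -> pointwise_inf F x <= q x.
Proof.
move=> pF Fq; apply: ge_inf; last by exists q.
by exists (p x) => _ [r Fr <-]; exact: pF.
Qed.

Lemma le_pointwise_inf {F} x a :
  (F !=set0)%classic -> (forall q, F q -> a <= q x) -> a <= pointwise_inf F x.
Proof.
move=> [q Fq] aF; apply: lb_le_inf; first by exists (q x), q.
by move=> _ [r Fr <-]; exact: aF.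
Qed.

(* The members of [F] need not be sublinear: subadditivity and homogeneity are
   only required up to moving inside [F]. *)
Lemma sublinear_pointwise_inf {F p} :
  (F !=set0)%classic -> (forall q x, F q -> p x <= q x) ->
  (forall q r x y, F q -> F r -> exists2 s, F s & s (x + y) <= q x + r y) ->
  (forall q (c : R) x, F q -> 0 < c -> exists2 s, F s & s (c *: x) <= c * q x) ->
  sublinear (pointwise_inf F).
Proof.
move=> F0 pF FD FZ; apply: sublinear_of_le => [x y|c x c0].
  rewrite -lerBlDr; apply: le_pointwise_inf => // q Fq.
  rewrite lerBlDr -lerBlDl; apply: le_pointwise_inf => // r Fr.
  rewrite lerBlDl; have [s Fs] := FD q r x y Fq Fr; apply: le_trans.
  exact: pointwise_inf_le pF Fs.
rewrite mulrC -ler_pdivrMr//; apply: le_pointwise_inf => // q Fq.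
rewrite ler_pdivrMr// mulrC; have [s Fs] := FZ q c x Fq c0; apply: le_trans.
exact: pointwise_inf_le pF Fs.
Qed.

Definition translates q (a : V) : set (V -> R) :=
  [set (fun x => q (x + t *: a) - t * q a) | t in [set t | 0 <= t]].

(** Subadditivity at [t *: a = (x + t *: a) + (- x)] bounds all translates from below, uniformly in
    [t]. *)
Lemma translates_lbound q a r x :
  sublinear q -> translates q a r -> - q (- x) <= r x.
Proof.
move=> sq [t /= t0 <-].
by have := sq.1 (x + t *: a) (- x); rewrite addrAC subrr add0r sq.2//; lra.
Qed.

Lemma translates_self q a : translates q a q.
Proof.
by exists 0 => //=; apply/funext => x; rewrite scale0r mul0r addr0 subr0.
Qed.

(** Parameters follow the vectors: adding [x] and [y] adds [s] and [t], and scaling [x] by [c]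
    scales [t] by [c]. *)
Lemma sublinear_inf_translates q a :
  sublinear q -> sublinear (pointwise_inf (translates q a)).
Proof.
move=> sq; apply: (@sublinear_pointwise_inf _ (fun x => - q (- x))).
- by exists q; exact: translates_self.
- by move=> r x; exact: translates_lbound.
- move=> _ _ x y [s /= s0 <-] [t /= t0 <-].
  exists (fun z => q (z + (s + t) *: a) - (s + t) * q a).
    by exists (s + t) => //=; rewrite addr_ge0.
  have := sq.1 (x + s *: a) (y + t *: a); rewrite addrACA -scalerDl; lra.
- move=> _ c x [t /= t0 <-] c0.
  exists (fun z => q (z + (c * t) *: a) - (c * t) * q a).
    by exists (c * t) => //=; rewrite mulr_ge0// ltW.
  by rewrite -scalerA -scalerDr (sq.2 _ _ (ltW c0)) mulrBr mulrA.
Qed.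

Lemma inf_translates_le q a t x : sublinear q -> 0 <= t ->
  pointwise_inf (translates q a) x <= q (x + t *: a) - t * q a.
Proof.
move=> sq t0; pose r y := q (y + t *: a) - t * q a.
apply: (@pointwise_inf_le _ (fun x => - q (- x)) r) => [s y|].
  exact: translates_lbound.
by exists t.
Qed.

Lemma minimal_sublinear_linear q : sublinear q ->
  (forall r, sublinear r -> (forall x, r x <= q x) -> r = q) ->
  linear (q : V -> R^o).
Proof.
move=> sq qmin.
have qD x y : q (x + y) = q x + q y.
  (* Minimality equates [q] with the infimum of its translates along [y]; the translate at [t = 1]
     then yields superadditivity. *)
  apply/eqP; rewrite eq_le sq.1/=.
  have /(congr1 (fun r => r x)) <- : pointwise_inf (translates q y) = q.
    apply: qmin => [|z]; first exact: sublinear_inf_translates.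
    by have := inf_translates_le q y 0 z sq (lexx _);
      rewrite scale0r mul0r addr0 subr0.
  have := inf_translates_le q y 1 x sq ler01; rewrite scale1r mul1r; lra.
have qN x : q (- x) = - q x.
  by apply/eqP; rewrite -addr_eq0 -qD addNr sublinear0.
move=> c x y; rewrite qD; congr (_ + _).
have [c0|c0] := leP 0 c; first exact: sq.2.
by rewrite -[c]opprK scaleNr qN sq.2 ?oppr_ge0 1?ltW// scaleNr.
Qed.

(** In a chain, the smaller of [q] and [r] witnesses subadditivity, and [- p (- x)] bounds all
    members from below. *)
Lemma chain_sublinear_inf {p} (A : set (V -> R)) : (A !=set0)%classic ->
  (forall q, A q -> sublinear q /\ forall x, q x <= p x) ->
  total_on A (fun q r => forall x, q x <= r x) ->
  sublinear (pointwise_inf A) /\ forall q x, A q -> pointwise_inf A x <= q x.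
Proof.
move=> A0 Ap tot.
have pA q x : A q -> - p (- x) <= q x.
  move=> /Ap[sq qp]; apply: le_trans (sublinear_ge_opp x sq).
  by rewrite lerN2.
split; last by move=> q x; exact: (@pointwise_inf_le _ (fun x => - p (- x))).
apply: (@sublinear_pointwise_inf _ (fun x => - p (- x))) => //.
  move=> q r x y Aq Ar; have [sq _] := Ap q Aq; have [sr _] := Ap r Ar.
  case: (tot q r Aq Ar) => qr.
    by exists q => //; rewrite (le_trans (sq.1 _ _))// lerD2l.
  by exists r => //; rewrite (le_trans (sr.1 _ _))// lerD2r.
move=> q c x Aq c0; exists q => //.
by rewrite (proj1 (Ap q Aq)).2// ltW.
Qed.

Lemma sublinear_dominates_linear {p} : sublinear p ->
  exists2 f : V -> R^o, linear f & forall x, f x <= p x.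
Proof.
move=> sp.
pose T := {q : V -> R | sublinear q /\ forall x, q x <= p x}.
(* The order is reversed, so that a maximal element for Zorn's lemma is a minimal functional. *)
pose le (q r : T) := `[< forall x, sval r x <= sval q x >].
have [|||A tot|[q [sq qp]] qmin] := @Zorn T le.
- by move=> q; apply/asboolP.
- move=> r q s /asboolP qr /asboolP rs; apply/asboolP => x.
  exact: le_trans (rs x) (qr x).
- move=> [q ?] [r ?] /asboolP/= qr /asboolP/= rq; apply/eq_exist/funext => x.
  by apply/eqP; rewrite eq_le qr rq.
- have [A0|/set0P[q Aq]] := eqVneq A set0.
    by exists (exist _ p (conj sp (fun=> lexx _))) => s; rewrite A0.
  have [|||sA leA] := @chain_sublinear_inf p [set sval q | q in A]%classic.
  + by exists (sval q), q.
  + by move=> _ [r _ <-]; exact: (svalP r).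
  + move=> _ _ [r Ar <-] [s As <-].
    by case: (tot r s Ar As) => /asboolP ?; [right|left].
  have Ap x : pointwise_inf [set sval q | q in A]%classic x <= p x.
    by apply: le_trans (leA (sval q) x _) _; [exists q|exact: (svalP q).2].
  exists (exist _ _ (conj sA Ap) : T) => s As; apply/asboolP => x /=.
  by apply: leA; exists s.
exists q => //; apply: minimal_sublinear_linear => // r sr rq.
have rp x : r x <= p x := le_trans (rq x) (qp x).
suff /(congr1 sval) :
  (exist _ r (conj sr rp) : T) = exist _ q (conj sq qp) by [].
by apply: qmin; apply/asboolP.
Qed.

(* At [- a] the infimum of the translates of [p] along [a] is at most [- p a],
   so a linear functional below it is at least [p a] at [a]. *)
Lemma hahn_banach_support {p} a : sublinear p ->
  exists f : V -> R^o, [/\ linear f, forall x, f x <= p x & f a = p a].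
Proof.
move=> sp.
have [f lf fp] := sublinear_dominates_linear (sublinear_inf_translates p a sp).
have fle x : f x <= p x.
  apply: le_trans (fp x) _.
  by have := inf_translates_le p a 0 x sp (lexx _);
    rewrite scale0r mul0r addr0 subr0.
exists f; split => //; apply/eqP; rewrite eq_le fle /=.
have fN : f (- a) = - f a.
  by rewrite -[in LHS]scaleN1r (GRing.scalable_linear lf)/= scaleN1r.
have := inf_translates_le p a 1 (- a) sp ler01.
rewrite scale1r mul1r addNr sublinear0// sub0r.
have := fp (- a); rewrite fN; lra.
Qed.

End sublinear_functionals.

(** * Norming functionals over real and complex scalars *)

Lemma norming_functional_real {R : realType} {V : normedModType R} (a : V) :
  exists f : V -> R^o, [/\ linear f, forall x, `|f x| <= `|x| & f a = `|a|].
Proof.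
have sN : sublinear (fun x : V => `|x|).
  by split=> [x y|c x c0]; rewrite ?ler_normD// normrZ ger0_norm.
have [f [lf fN fa]] := hahn_banach_support a sN.
exists f; split => // x; rewrite ler_norml fN andbT lerNl.
have <- : f (- x) = - f x.
  by rewrite -[in LHS]scaleN1r (GRing.scalable_linear lf)/= scaleN1r.
by rewrite -normrN.
Qed.

(** A separate name for [V] carries the real scaling alongside the complex one. *)
Definition realification {R : realType} (V : lmodType R[i]) : Type := V.

Section realification_lmodule.
Context {R : realType} {V : lmodType R[i]}.

HB.instance Definition _ := GRing.Zmodule.on (realification V).

Let scale (c : R) (x : realification V) : realification V := c%:C%C *: (x : V).

Let scaleA c d x : scale c (scale d x) = scale (c * d) x.
Proof. by rewrite /scale rmorphM scalerA. Qed.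

Let scale1 : left_id 1 scale.
Proof. by move=> x; rewrite /scale rmorph1 scale1r. Qed.

Let scaleDr : right_distributive scale +%R.
Proof. by move=> c x y; rewrite /scale scalerDr. Qed.

Let scaleDl x : {morph scale^~ x : c d / c + d}.
Proof. by move=> c d; rewrite /scale rmorphD scalerDl. Qed.

HB.instance Definition _ := GRing.Zmodule_isLmodule.Build R (realification V)
  scaleA scale1 scaleDr scaleDl.

Lemma realification_scaleE (c : R) (x : V) :
  c *: (x : realification V) = c%:C%C *: x.
Proof. by []. Qed.

(* A complex-linear functional is determined by its real part [f], as
   [x |-> f x - i f (i x)]. *)
Lemma complexified_linear (f : realification V -> R^o) : linear f ->
  linear ((fun x : V => (f x +i* - f ('i%C *: x))%C) : V -> R[i]^o).
Proof.
move=> lf c x y.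
(* Both [c *: x + y] and its multiple by [i] are brought to this form with real coefficients. *)
have fE (b d : R) (u v w : V) :
    f (b%:C%C *: u + (d%:C%C *: v + w)) = b * f u + (d * f v + f w).
  by rewrite -!realification_scaleE !lf.
case: c => b d.
have -> : (b +i* d)%C *: x + y = b%:C%C *: x + (d%:C%C *: ('i%C *: x) + y).
  rewrite scalerA addrA -scalerDl; congr (_ *: _ + _).
  by apply/eqP; rewrite eq_complex /=; apply/andP; split; apply/eqP; ring.
have -> : 'i%C *: (b%:C%C *: x + (d%:C%C *: ('i%C *: x) + y)) =
    b%:C%C *: ('i%C *: x) + ((- d)%:C%C *: x + 'i%C *: y).
  rewrite !scalerDr !scalerA; congr (_ *: _ + (_ *: _ + _)).
    by rewrite mulrC.
  by apply/eqP; rewrite eq_complex /=; apply/andP; split; apply/eqP; ring.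
rewrite !fE; apply/eqP; rewrite eq_complex /=.
by apply/andP; split; apply/eqP; rewrite /=; ring.
Qed.

End realification_lmodule.

Lemma norming_functional_complex {R : realType} {V : normedModType R[i]}
    (a : V) :
  exists f : V -> R[i]^o, [/\ linear f, forall x, `|f x| <= `|x| & f a = `|a|].
Proof.
pose N (x : realification V) : R := complex.Re `|x : V|.
have NE (x : V) : `|x| = (N x)%:C%C.
  exact: esym (@real_of_scalarK R ComplexScalars _ (normr_ge0 x)).
have sN : sublinear N.
  split=> [x y|c x c0].
    by rewrite -lecR rmorphD /= -!NE ler_normD.
  apply: (@complexI R); rewrite -NE rmorphM /= -NE realification_scaleE normrZ.
  by rewrite ger0_norm// lecR.
have [f [lf fN fa]] := hahn_banach_support (a : realification V) sN.
pose g (x : V) : R[i]^o := (f x +i* - f ('i%C *: x))%C.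
have lg : linear g := complexified_linear f lf.
have gZ c x : g (c *: x) = c * g x.
  exact: GRing.scalable_linear lg c x.
have gN x : `|g x| <= `|x|.
  have [->|gx0] := eqVneq (g x) 0; first by rewrite normr0.
  (* Multiplying [x] by the conjugate of [g x] makes [g u] the real number [r * r], so
     [f u <= N u = r * N x] gives [r <= N x]. *)
  set u := (g x)^*%C *: x; pose r := complex.Re `|g x : R[i]|.
  have rE : `|g x : R[i]| = r%:C%C.
    exact: esym (@real_of_scalarK R ComplexScalars _ (normr_ge0 (g x : R[i]))).
  have fu : f u = r * r.
    suff : g u = (r * r)%:C%C by move=> /(congr1 (@complex.Re R)).
    by rewrite gZ mulrC -sqr_normc rE -rmorphXn /= expr2.
  have Nu : N u = r * N x.
    by apply: (@complexI R); rewrite rmorphM /= -!NE -rE normrZ normcJ.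
  have r0 : 0 < r by rewrite -ltcR -rE normr_gt0.
  by rewrite (rE : `|g x| = _) NE lecR -(ler_pM2l r0) -fu -Nu.
exists g; split => //.
(* The real part of [g a] is already [N a], so [|g a| <= N a] forces the imaginary part to
   vanish. *)
have : (N a ^+ 2 + (complex.Im (g a)) ^+ 2)%:C%C <= (N a ^+ 2)%:C%C.
  rewrite -fa (add_Re2_Im2 (g a)) fa rmorphXn /= -NE.
  by rewrite ler_pXn2r ?nnegrE ?normr_ge0// gN.
rewrite lecR gerDl => Im2.
have : complex.Im (g a) ^+ 2 == 0 by rewrite eq_le Im2 sqr_ge0.
rewrite sqrf_eq0 => /eqP Im0.
by rewrite NE; apply/eqP; rewrite eq_complex /= fa eqxx; apply/eqP.
Qed.

(** * Norm attainment of the adjoint *)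

Section norm_attainment_adjoint.
Context {R : realType} {k : scalar_kind}.

(** The bound is [<= 1] rather than [= 1] because the zero space has no functional of norm one. *)
Lemma norming_functional {Y : normedModType (scalars R k)} (y : Y) :
  exists2 ystar : dual Y, `|ystar| <= 1 & ystar y = `|y|.
Proof.
have [f [lf fN fy]] : exists f : Y -> (scalars R k)^o,
    [/\ linear f, forall x, `|f x| <= `|x| & f y = `|y|].
  case: k Y y => Y y; first exact: norming_functional_real.
  exact: norming_functional_complex.
have bf : f \in @bounded_linear _ Y (scalars R k)^o.
  by apply/asboolP; split => //; exists 1 => x; rewrite mul1r.
exists (BoundedOp bf) => //; rewrite opnormE; apply: opnorm_least => // x x1.
exact: le_trans (fN x) x1.
Qed.

Context {X Y : normedModType (scalars R k)}.

Lemma adjoint_norm_attained (T : bounded_op X Y) (y0 : Y) (ystar : dual Y) :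
  quasi_attains_norm_toward T y0 -> `|ystar| <= 1 -> ystar y0 = `|y0| ->
  `|adjoint T ystar| = `|adjoint T|.
Proof.
move=> [y0cl y0T] ystar1 ystary0; apply/eqP; rewrite eq_le; apply/andP; split.
  exact: opnorm_ub.
have ystar_le y : `|ystar y| <= `|y|.
  by rewrite (le_trans (opnormP ystar y))// ler_piMl.
apply: (@le_trans _ _ `|T|).
  apply: opnorm_least => // g g1; apply: opnorm_least => // x x1.
  rewrite (le_trans (opnormP g _))// (le_trans (ler_piMl _ g1))//.
  exact: opnorm_ub.
rewrite -y0T; apply/ler_addgt0Pr => e e0.
have [_ [[x x1 <-]]] := y0cl _ (nbhsx_ballx y0 e e0).
rewrite -ball_normE /= => /ltW Txe.
(* In [y0 = (y0 - T x) + T x], the first term contributes at most [e] under [ystar], and the second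
   is [adjoint T ystar] evaluated at [x]. *)
rewrite -[leLHS]normr_id -ystary0 -[y0](subrK (T x)) linearD.
rewrite [leRHS]addrC (le_trans (ler_normD _ _))// lerD//.
  exact: le_trans (ystar_le _) Txe.
exact: (opnorm_ub (adjoint T ystar) x1).
Qed.

End norm_attainment_adjoint.

Theorem proposition3p3 (R : realType) (k : scalar_kind)
    (X Y : completeNormedModType (scalars R k)) (T : bounded_op X Y) :
  (QNA T -> NA (adjoint T)) /\
  (forall y0 : Y, quasi_attains_norm_toward T y0 ->
    forall ystar : dual Y, unit_sphere (dual Y) ystar -> ystar y0 = `|y0| ->
      attains_norm_at (adjoint T) ystar).
Proof.
split=> [[y0 Ty0]|y0 Ty0 ystar ystar1 ystary0].
  have [ystar ystar1 ystary0] := norming_functional y0.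
  exists ystar; first exact: ystar1.
  exact: adjoint_norm_attained Ty0 ystar1 ystary0.
split=> //; apply: adjoint_norm_attained Ty0 _ ystary0.
by rewrite ystar1.
Qed.
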